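(* The Zariski topology of $\operatorname{End}(\mathbb{X})$ is the pointwise topology whenever $\mathbb{X}$ is one of the following structures: (i) the random graph; (ii) the random directed graph; (iii) $(\mathbb{Q},<)$; (iv) the random tournament; (v) the random strict partial order; (vi) $n\mathbb{K}_\omega$ (without loops) for every $n\in(\mathbb{N}\setminus\{0\})\cup\{\omega\}$; (vii) any structure $\mathbb{Y}$ with a first-order definition in one of the structures $\mathbb{X}$ in items (i)-(iv) which (like $\mathbb{X}$) has no endomorphism sending a pair in the relation of $\mathbb{X}$ onto a loop (i.e. there are no $f\in\operatorname{End}(\mathbb{Y})$ and no pair $(x,y)$ in the binary relation of $\mathbb{X}$ with $(x)f=(y)f$); this is in particular the case for all expansions of the structures $\mathbb{X}$ in (i)-(iv) by first-order definable relations.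
   Context: Functions are written on the right of their arguments and composed from left to right. $\operatorname{End}(\mathbb{X})$ is the endomorphism monoid of $\mathbb{X}$. The random graph, random directed graph, random tournament, random strict partial order are the Fra\''iss\'e limits of the classes of all finite loopless undirected graphs, all finite directed graphs, all finite tournaments, all finite strict partial orders, respectively; each has a single binary relation. A directed graph is a set with an irreflexive binary relation that need not be symmetric or antisymmetric. $n\mathbb{K}_\omega$ is the disjoint union of $n$ copies of the complete loopless graph on countably infinitely many vertices. A structure $\mathbb{Y}$ has a first-order definition in $\mathbb{X}$ if it has the same domain as $\mathbb{X}$ and everything named in its signature is definable in $\mathbb{X}$ by a first-order formula without parameters. The Zariski topology on a monoid $S$ is the topology with subbasis consisting of the sets $\{s\in S : (s)\phi_1\neq (s)\phi_2\}$, where $\phi_1,\phi_2\colon S\to S$ are any functions of the form $(s)\phi_1=t_1st_2s\cdots t_{k-1}st_k$ and $(s)\phi_2=u_1su_2s\cdots u_{l-1}su_l$ for some $k,l\geq 1$ and fixed $t_1,\ldots,t_k,u_1,\ldots,u_l\in S$. The pointwise topology on a set $S$ of functions from $X$ to $X$ has subbasis the sets $\{f\in S : (x)f=y\}$, $x,y\in X$. *)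

(* Defs.v *)
From HB Require Import structures.
From mathcomp Require Import all_boot all_order all_algebra.
From mathcomp Require Import all_classical.
From mathcomp Require Import topology_structure.

Set Implicit Arguments.
Unset Strict Implicit.
Unset Printing Implicit Defensive.

Local Open Scope classical_set_scope.

(* Constants are function symbols of arity 0. *)
Record signature := Signature {
  fsym : Type;
  farity : fsym -> nat;
  rsym : Type;
  rarity : rsym -> nat }.

(* An n-tuple of elements of D is a function 'I_n -> D.  The domain D is a
   parameter, so that two structures over different signatures can share it. *)
Record structure (L : signature) (D : Type) := Structure {
  finterp : forall g : fsym L, ('I_(farity g) -> D) -> D;
  rinterp : forall r : rsym L, ('I_(rarity r) -> D) -> Prop }.

Definition is_endo L D (Y : structure L D) (f : D -> D) : Prop :=
  (forall (g : fsym L) (a : 'I_(farity g) -> D),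
      f (finterp Y a) = finterp Y (f \o a)) /\
  (forall (r : rsym L) (a : 'I_(rarity r) -> D),
      rinterp Y a -> rinterp Y (f \o a)).

Record endo L D (Y : structure L D) := Endo {
  endo_fun :> D -> D;
  endoP : is_endo Y endo_fun }.

Section EndoMonoid.
Variables (L : signature) (D : Type) (Y : structure L D).

Lemma endo_inj (f g : endo Y) : (f : D -> D) = g -> f = g.
Proof.
case: f g => f pf [g pg] /= fg; rewrite fg in pf *.
by rewrite (Prop_irrelevance pf pg).
Qed.

HB.instance Definition _ := gen_eqMixin (endo Y).
HB.instance Definition _ := gen_choiceMixin (endo Y).

Lemma is_endo_id : is_endo Y id.
Proof. by split. Qed.

Lemma is_endo_comp (f g : endo Y) : is_endo Y (g \o f).
Proof.
case: f g => f [ff fr] [g [gf gr]]; split => [s a|r a ra] /=.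
  by rewrite ff gf.
by apply: (gr r (f \o a)); apply: fr.
Qed.

Definition endo_one : endo Y := Endo is_endo_id.

(* Functions act on the right: in a product, the left factor acts first. *)
Definition endo_mul (f g : endo Y) : endo Y := Endo (is_endo_comp f g).

Lemma endo_mulA : associative endo_mul.
Proof. by move=> f g h; apply: endo_inj. Qed.

Lemma endo_mul1 : left_id endo_one endo_mul.
Proof. by move=> f; apply: endo_inj. Qed.

Lemma endo_1mul : right_id endo_one endo_mul.
Proof. by move=> f; apply: endo_inj. Qed.

HB.instance Definition _ :=
  isMonoid.Build (endo Y) endo_mulA endo_mul1 endo_1mul.

End EndoMonoid.

(* s |-> t s t_2 s ... s t_k, where ts = [:: t_2; ...; t_k] *)
Definition word_map (S : monoidType) (t : S) (ts : seq S) (s : S) : S :=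
  foldl (fun w u => (w * s * u)%g) t ts.

Definition zariski_subbasis (S : monoidType) : set (set S) :=
  [set U | exists (t : S) (ts : seq S) (u : S) (us : seq S),
     U = [set s | word_map t ts s <> word_map u us s]].

Definition zariski (S : monoidType) : Type := S.

HB.instance Definition _ (S : monoidType) := Choice.on (zariski S).
HB.instance Definition _ (S : monoidType) :=
  isSubBaseTopological.Build (zariski S) (@zariski_subbasis S) id.

Definition pointwise_subbasis L D (Y : structure L D) : set (set (endo Y)) :=
  [set U | exists x y : D, U = [set f : endo Y | f x = y]].

Definition pointwise L D (Y : structure L D) : Type := endo Y.

HB.instance Definition _ L D (Y : structure L D) := Choice.on (pointwise Y).
HB.instance Definition _ L D (Y : structure L D) :=
  isSubBaseTopological.Build (pointwise Y) (@pointwise_subbasis L D Y) id.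

Definition zariski_is_pointwise L D (Y : structure L D) : Prop :=
  (@open (zariski (endo Y)) : set (set (endo Y))) = @open (pointwise Y).

Inductive term (L : signature) (n : nat) : Type :=
| Var of 'I_n
| App (g : fsym L) of ('I_(farity g) -> term L n).

(* [formula L n]: formulas with free variables among n variables.  The
   quantifier binds variable 0 and shifts the others up by one. *)
Inductive formula (L : signature) : nat -> Type :=
| FFalse n : formula L n
| FEq n : term L n -> term L n -> formula L n
| FRel n (r : rsym L) : ('I_(rarity r) -> term L n) -> formula L n
| FImp n : formula L n -> formula L n -> formula L n
| FAll n : formula L n.+1 -> formula L n.

Definition tcons D n (x : D) (v : 'I_n -> D) : 'I_n.+1 -> D :=
  fun i => if unlift ord0 i is Some j then v j else x.

Fixpoint eval L D (X : structure L D) n (v : 'I_n -> D) (t : term L n) : D :=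
  match t with
  | Var i => v i
  | App g ts => @finterp L D X g (fun i => eval X v (ts i))
  end.

Fixpoint sat L D (X : structure L D) n (phi : formula L n) :
    ('I_n -> D) -> Prop :=
  match phi in formula _ m return ('I_m -> D) -> Prop with
  | FFalse _ => fun v => False
  | FEq _ t u => fun v => eval X v t = eval X v u
  | FRel _ r ts => fun v => @rinterp L D X r (fun i => eval X v (ts i))
  | FImp _ phi psi => fun v => sat X phi v -> sat X psi v
  | FAll _ phi => fun v => forall x : D, sat X phi (tcons x v)
  end.

Definition definable_rel L D (X : structure L D) n
    (P : ('I_n -> D) -> Prop) : Prop :=
  exists phi : formula L n, forall v, sat X phi v <-> P v.

(* A function is definable when its graph is. *)
Definition definable_fun L D (X : structure L D) n
    (F : ('I_n -> D) -> D) : Prop :=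
  exists phi : formula L n.+1,
    forall y v, sat X phi (tcons y v) <-> F v = y.

Definition fo_definition L D (X : structure L D) L' (Y : structure L' D) :=
  (forall g : fsym L', definable_fun X (@finterp L' D Y g)) /\
  (forall r : rsym L', definable_rel X (@rinterp L' D Y r)).

Definition expansion_sig (L : signature) (I : Type) (ar : I -> nat) :=
  @Signature (fsym L) (@farity L) (rsym L + I)
    (fun s => match s with inl r => rarity r | inr i => ar i end).

Definition expansion L D (X : structure L D) (I : Type) (ar : I -> nat)
    (P : forall i, ('I_(ar i) -> D) -> Prop) :
    structure (expansion_sig L ar) D :=
  @Structure (expansion_sig L ar) D (@finterp L D X)
    (fun s => match s return ('I_(@rarity (expansion_sig L ar) s) -> D) -> Prop
              with inl r => @rinterp L D X r | inr i => P i end).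

Definition binary_sig : signature :=
  @Signature void (fun=> 0) unit (fun=> 2).

Definition binary D (R : D -> D -> Prop) : structure binary_sig D :=
  @Structure binary_sig D (fun g => match g with end)
    (fun _ a => R (a ord0) (a ord_max)).

Definition no_loop D (R : D -> D -> Prop) L (Y : structure L D) : Prop :=
  ~ exists (f : endo Y) (x y : D), R x y /\ f x = f y.

Definition fclass := forall F : finType, rel F -> Prop.

Definition embeds (F : finType) (r : rel F) D (R : D -> D -> Prop) : Prop :=
  exists f : F -> D, injective f /\ forall a b, r a b <-> R (f a) (f b).

Definition automorphism D (R : D -> D -> Prop) (h : D -> D) : Prop :=
  bijective h /\ forall x y, R x y <-> R (h x) (h y).

(* Every isomorphism p between finite induced substructures (on A and on
   p @` A) extends to an automorphism; the values of p outside A are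
   irrelevant. *)
Definition homogeneous D (R : D -> D -> Prop) : Prop :=
  forall (A : set D) (p : D -> D), finite_set A -> set_inj A p ->
    (forall x y, A x -> A y -> (R x y <-> R (p x) (p y))) ->
  exists h, automorphism R h /\ forall x, A x -> h x = p x.

(* By Fraisse's theorem this determines (D, R) up to isomorphism. *)
Definition fraisse_limit (K : fclass) D (R : D -> D -> Prop) : Prop :=
  [/\ countable [set: D], homogeneous R &
      forall (F : finType) (r : rel F), K F r <-> embeds r R].

Definition finite_graph : fclass :=
  fun F r => irreflexive r /\ symmetric r.

Definition finite_digraph : fclass := fun F r => irreflexive r.

Definition finite_tournament : fclass :=
  fun F r => irreflexive r /\ forall x y, x != y -> r x y (+) r y x.

Definition finite_strict_order : fclass :=
  fun F r => irreflexive r /\ transitive r.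

Definition random_graph D (R : D -> D -> Prop) :=
  fraisse_limit finite_graph R.
Definition random_digraph D (R : D -> D -> Prop) :=
  fraisse_limit finite_digraph R.
Definition random_tournament D (R : D -> D -> Prop) :=
  fraisse_limit finite_tournament R.
Definition random_strict_order D (R : D -> D -> Prop) :=
  fraisse_limit finite_strict_order R.

Definition ltQ (x y : rat) : Prop := (x < y)%R.

(* Disjoint union of complete loopless graphs on nat, one for each c : C. *)
Definition copies_Komega (C : Type) (x y : C * nat) : Prop :=
  x.1 = y.1 /\ x.2 <> y.2.

Inductive base_structure : forall D, (D -> D -> Prop) -> Prop :=
| Base_random_graph D (R : D -> D -> Prop) :
    random_graph R -> base_structure R
| Base_random_digraph D (R : D -> D -> Prop) :
    random_digraph R -> base_structure R
| Base_rat_order : base_structure ltQ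
| Base_random_tournament D (R : D -> D -> Prop) :
    random_tournament R -> base_structure R.

(* Main.v *)
Require Import Defs.
From mathcomp Require Import all_boot all_order all_algebra.
From mathcomp Require Import all_classical topology_structure.
From mathcomp Require Import lra zify.

(** A Zariski-open set is always pointwise open.  Conversely, if endomorphisms
    a and b differ exactly at y, then [g s a <> g s b] says that the image of g
    meets the fibre of s over y.  In all the structures at hand a fibre contains
    no related pair, so it suffices to find g1 and g2 whose images share x and
    are otherwise completely related to each other: a fibre meeting both images
    must contain x, and [{s | x s = y}] is an intersection of two Zariski-open
    sets.

    In a Fraisse limit D these maps come from embedding a suitable structure on
    two copies of D back into D.  By homogeneity a self-embedding agrees on every
    finite tuple with an automorphism, so it preserves all first-order definable
    relations, whence (vii).  In the random strict order no amalgam of two copies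
    of D has all cross pairs comparable, so g1 and g2 factor through a linear
    extension instead of being embeddings. *)

Set Implicit Arguments.
Unset Strict Implicit.
Unset Printing Implicit Defensive.

Import Order.TTheory GRing.Theory Num.Theory.

Local Open Scope classical_set_scope.

(** * The Zariski topology against the pointwise topology *)

Section ZariskiPointwise.
Variables (L : signature) (D : Type) (Y : structure L D).

Lemma open_eval_eq (x y : D) :
  open ([set f : endo Y | f x = y] : set (pointwise Y)).
Proof.
set U := (X in open X); exists [set U]; last by rewrite bigcup_set1.
by move=> A ->; apply: (@finI_from1 _ _ _ id); exists x, y.
Qed.

Lemma open_word_neq (t u : endo Y) (ts us : seq (endo Y)) :
  open ([set s : endo Y | word_map t ts s <> word_map u us s] :
    set (zariski (endo Y))).
Proof.
set U := (X in open X); exists [set U]; last by rewrite bigcup_set1.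
by move=> A ->; apply: (@finI_from1 _ _ _ id); exists t, ts, u, us.
Qed.

Lemma near_eval (s : pointwise Y) (x : D) :
  \forall s' \near s, (s' : endo Y) x = (s : endo Y) x.
Proof.
by apply: open_nbhs_nbhs; split; first exact: open_eval_eq.
Qed.

(** A word applies [s] only finitely often on the way from [x], and each of these values is locally
    constant in the pointwise topology. *)
Lemma near_word_map (s : pointwise Y) (t : endo Y) (ts : seq (endo Y)) (x : D) :
  \forall s' \near s, word_map t ts (s' : endo Y) x = word_map t ts (s : endo Y) x.
Proof.
elim/last_ind: ts x => [|ts u IH] x; first exact: filterE.
have [A B] := (IH x, near_eval s (word_map t ts (s : endo Y) x)).
apply: filterS2 A B => s' A B; rewrite /word_map !foldl_rcons.
by rewrite /= -!/(word_map _ _ _) A B.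
Qed.

(** If two words differ at [s], they differ at some point [x], and for all [s'] near [s] their
    values at [x] are the same as for [s]. *)
Lemma open_zariski_pointwise (U : set (endo Y)) :
  open (U : set (zariski (endo Y))) -> open (U : set (pointwise Y)).
Proof.
case=> B sB <-; apply: bigcup_open => _ /sB[F sF <-].
rewrite bigcap_fset big_seq; apply: big_ind => [|A C|V /sF]; first exact: openT.
  exact: openI.
case/set_mem=> t [ts [u [us ->]]]; rewrite openE => s /= tu_s.
have [x tu_x] : exists x, word_map t ts s x <> word_map u us s x.
  apply: contrapT => /forallNP tu; apply: tu_s; apply/endo_inj/funext => x.
  exact: contrapT (tu x).
have := near_word_map s u us x; apply: filterS2 (near_word_map s t ts x).
by move=> s' /= Et Eu E; apply: tu_x; rewrite -Et -Eu E.
Qed.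

Lemma zariski_is_pointwiseP :
  (forall y, exists a b : endo Y, a y <> b y /\ forall z, z <> y -> a z = b z) ->
  (forall x, exists g1 g2 : endo Y,
    [/\ exists z, g1 z = x, exists z, g2 z = x &
        forall (s : endo Y) z1 z2, s (g1 z1) = s (g2 z2) -> s (g1 z1) = s x]) ->
  zariski_is_pointwise Y.
Proof.
move=> sep cover; apply/seteqP; split => U; first exact: open_zariski_pointwise.
case=> B sB <-; apply: (@bigcup_open (zariski (endo Y))) => _ /sB[F sF <-].
rewrite bigcap_fset big_seq; apply: big_ind => [|A C|V /sF]; first exact: openT.
  exact: openI.
case/set_mem=> x [y ->]; have [a [b [ab_y ab]]] := sep y.
have [g1 [g2 [[z1 g1z] [z2 g2z] g12]]] := cover x.
have -> : [set f : endo Y | f x = y] =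
    [set s : endo Y | word_map g1 [:: a] s <> word_map g1 [:: b] s] `&`
    [set s : endo Y | word_map g2 [:: a] s <> word_map g2 [:: b] s].
  apply/seteqP; split => [s sx|s [/= h1 h2]].
    by split => /(congr1 (fun f : endo Y => (f : D -> D)));
       [move/(congr1 (@^~ z1)) | move/(congr1 (@^~ z2))];
       rewrite /= ?g1z ?g2z sx.
  have meet (g : endo Y) : word_map g [:: a] s <> word_map g [:: b] s ->
      exists z, s (g z) = y.
    (* If the fibre over [y] misses the image of [g], then [a] and [b] agree on everything they are
       applied to. *)
    move=> h; apply: contrapT => /forallNP sg; apply: h.
    by apply/endo_inj/funext => z; exact: ab (sg z).
  by have [[u1 E1] [u2 E2]] := (meet _ h1, meet _ h2); rewrite -E1 (g12 s u1 u2) ?E1.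
by apply: openI; exact: open_word_neq.
Qed.

End ZariskiPointwise.

(** * Embeddings into homogeneous structures and Fraisse limits *)

Definition embedding N (S : N -> N -> Prop) D (R : D -> D -> Prop)
    (e : N -> D) : Prop :=
  injective e /\ forall a b, S a b <-> R (e a) (e b).

Lemma embedding_comp N (S : N -> N -> Prop) D (R : D -> D -> Prop)
    E (T : E -> E -> Prop) (e : N -> D) (f : D -> E) :
  embedding S R e -> embedding R T f -> embedding S T (f \o e).
Proof.
move=> [ei eS] [fi fR]; split; first exact: inj_comp.
by move=> a b; apply: iff_trans (fR _ _).
Qed.

Lemma automorphism_embedding D (R : D -> D -> Prop) (h : D -> D) :
  automorphism R h -> embedding R R h.
Proof. by case=> /bij_inj. Qed.

(** * Definable relations under automorphisms and self-embeddings *)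

Section Definability.
Variables (D : Type) (R : D -> D -> Prop).

Lemma eval_binary (h : D -> D) n (v : 'I_n -> D) (t : term binary_sig n) :
  eval (binary R) (h \o v) t = h (eval (binary R) v t).
Proof. by case: t => [|[]]. Qed.

Lemma comp_tcons (h : D -> D) n (x : D) (v : 'I_n -> D) :
  h \o tcons x v = tcons (h x) (h \o v).
Proof. by apply: funext => i; rewrite /tcons /=; case: (unlift ord0 i). Qed.

Lemma sat_automorphism (h : D -> D) n (phi : formula binary_sig n)
    (v : 'I_n -> D) :
  automorphism R h -> sat (binary R) phi v <-> sat (binary R) phi (h \o v).
Proof.
case=> -[k hK kK] hR.
elim: phi v => {n} [n|n t u|n r ts|n p IHp q IHq|n p IH] v //=.
- by rewrite !eval_binary; split => [->|/(can_inj hK)].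
- by rewrite !eval_binary.
- by rewrite -(propext (IHp v)) -(propext (IHq v)).
- split => pv x; last by apply/(IH _).2; rewrite comp_tcons.
  (* Surjectivity of [h] is what carries the quantifier over. *)
  by rewrite -(kK x) -comp_tcons; apply/(IH _).1.
Qed.

Hypothesis homR : homogeneous R.

Lemma embedding_automorphism (e : D -> D) n (v : 'I_n -> D) :
  embedding R R e -> exists h, automorphism R h /\ h \o v = e \o v.
Proof.
move=> [ei eR]; have [|||h [ah he]] := @homR (range v) e.
- exact: finite_image v finite_finset.
- by move=> x y _ _; apply: ei.
- by move=> x y _ _.
by exists h; split=> //; apply: funext => i; apply: he; exists i.
Qed.

Lemma embedding_endo L (Y : structure L D) (e : D -> D) :
  fo_definition (binary R) Y -> embedding R R e -> is_endo Y e.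
Proof.
move=> [defF defR] eR; split => [g a|r a].
  have [phi phiE] := defF g; apply/esym/(phiE _ _).1; rewrite -comp_tcons.
  (* The value is put in front of its arguments, so that a single automorphism agrees with [e] on
     both. *)
  have [h [ah <-]] := embedding_automorphism (tcons (finterp Y a) a) eR.
  by apply: (sat_automorphism _ _ ah).1; apply: (phiE _ _).2.
have [phi phiE] := defR r; have [h [ah <-]] := embedding_automorphism a eR.
move=> ra; apply: (phiE _).1; apply: (sat_automorphism _ _ ah).1.
exact: (phiE _).2 ra.
Qed.

End Definability.

(** * Universality of Fraisse limits for countable structures *)

Section Universality.
Variables (K : fclass) (D : Type) (R : D -> D -> Prop).
Hypothesis limR : fraisse_limit K R.
Variables (d0 : D) (N : Type) (S : N -> N -> Prop) (c : N -> nat).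
Hypothesis c_inj : injective c.
Hypothesis ageS : forall (F : finType) (f : F -> N), injective f ->
  K (fun a b : F => `[< S (f a) (f b) >]).

(** A finite stage of the construction: the values of [e] at points with code at least [n] are
    arbitrary. *)
Let partial (n : nat) (e : N -> D) : Prop :=
  forall a b, (c a < n)%N -> (c b < n)%N ->
    (e a = e b -> a = b) /\ (S a b <-> R (e a) (e b)).

Lemma initial_segment_embeds n : exists e, partial n e.
Proof.
(* Only attained codes are kept, since [c] need not be surjective; [f] decodes them. *)
pose F := {i : 'I_n | `[< exists a, c a = i >]}.
have FP (i : F) : exists a, c a = val i by apply/asboolP/(valP i).
have [f fE] := choice FP.
have f_inj : injective f.
  by move=> i j ij; have := fE i; rewrite ij fE => /val_inj/val_inj.
case: limR => _ _ /(_ F _)/iffLR/(_ (ageS f_inj))[g [g_inj gR]].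
have [e eE] : exists e : N -> D, forall i, e (f i) = g i.
  exists (fun a => if pselect (exists i, f i = a) is left p
                   then g (sval (cid p)) else d0) => i.
  case: pselect => [p|[]]; last by exists i.
  by case: cid => j /= /f_inj ->.
have fK a : (c a < n)%N -> exists i, f i = a.
  move=> can; have ai : `[< exists b, c b = Ordinal can >].
    by apply/asboolP; exists a.
  by exists (Sub (Ordinal can) ai); apply: c_inj; rewrite fE.
exists e => a b /fK[i <-] /fK[j <-]; rewrite !eE; split; first by move/g_inj->.
by rewrite -gR; split => /asboolP.
Qed.

(** The larger segment is embedded afresh by [g]. On the old points, [g a] to [e a] is a finite
    partial isomorphism, which homogeneity extends to an automorphism [h]; then [h \o g] extends
    [e]. *)
Lemma partial_extend n e : partial n e ->
  exists2 e', partial n.+1 e' & forall a, (c a < n)%N -> e' a = e a.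
Proof.
move=> pe; have [g pg] := initial_segment_embeds n.+1.
case: limR => _ homR _.
pose A := g @` [set a | (c a < n)%N].
have [p pE] : exists p : D -> D, forall a, (c a < n)%N -> p (g a) = e a.
  exists (fun x => if pselect (exists2 a, (c a < n)%N & g a = x) is left p
                   then e (s2val (cid2 p)) else d0) => a can.
  case: pselect => [q|[]]; last by exists a.
  case: cid2 => b /= cbn gba; congr e.
  by apply: (pg b a _ _).1 gba; apply: ltnW.
have [||x y [a can <-] [b cbn <-]|h [ah hE]] := homR A p.
- apply: finite_image; apply: (finite_preimage (B := `I_n)) => //.
  by move=> x y _ _; apply: c_inj.
- move=> x y /set_mem[a can <-] /set_mem[b cbn <-]; rewrite !pE //.
  by move/(pe a b can cbn).1 ->.
- rewrite !pE // -(pe a b can cbn).2.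
  by rewrite (pg a b _ _).2 //; apply: ltnW.
have [hi hR] := automorphism_embedding ah.
exists (h \o g) => [a b ca cb|a can /=].
  have [g1 g2] := pg a b ca cb; split; first by move/hi/g1.
  by rewrite g2 /= hR.
by rewrite hE ?pE //; exists a.
Qed.

(** Iterating the extension step gives a coherent chain of finite stages, whose limit is the
    embedding. *)
Lemma fraisse_limit_universal : exists e, embedding S R e.
Proof.
have step n (e : {e | partial n e}) :
    {e' : {e' | partial n.+1 e'} | forall a, (c a < n)%N -> sval e' a = sval e a}.
  apply: cid; have [e' pe' ee'] := partial_extend (svalP e).
  by exists (exist _ e' pe').
pose E := nat_rect (fun n => {e | partial n e})
  (cid (initial_segment_embeds 0)) (fun n e => sval (step n e)).
have ES m n a : (c a < m)%N -> (m <= n)%N -> sval (E n) a = sval (E m) a.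
  move=> cam /subnKC <-; elim: (n - m)%N => [|k IH]; first by rewrite addn0.
  rewrite addnS -IH /=; case: (step _ (E (m + k)%N)) => e' /= -> //.
  exact: ltn_addr.
(* Stage [(c a).+1] is the first one that controls [a]; later stages keep its value. *)
pose e a := sval (E (c a).+1) a.
have eE n a : (c a < n)%N -> e a = sval (E n) a by move=> can; rewrite (ES (c a).+1 n).
have eP a b : (e a = e b -> a = b) /\ (S a b <-> R (e a) (e b)).
  pose n := (maxn (c a) (c b)).+1.
  have can : (c a < n)%N by rewrite ltnS leq_maxl.
  have cbn : (c b < n)%N by rewrite ltnS leq_maxr.
  by rewrite !(eE n) //; apply: (svalP (E n)).
by exists e; split => [a b|a b]; [apply: (eP a b).1|exact: (eP a b).2].
Qed.

End Universality.

(** * Ages, and the rational order as a Fraisse limit *)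

Section Age.
Variables (K : fclass) (D : Type) (R : D -> D -> Prop).
Hypothesis limR : fraisse_limit K R.

(** Inclusion embeds a finite substructure, so it belongs to [K]. In this way universal axioms pass
    from [K] to [R]. *)
Lemma fraisse_limit_age (s : seq {classic D}) :
  K (fun a b : seq_sub s => `[< R (ssval a) (ssval b) >]).
Proof.
have [_ _ KE] := limR; apply/(KE _ _).2; exists (fun a => ssval a).
by split=> [|a b]; [exact: val_inj|split => /asboolP].
Qed.

Lemma fraisse_limit_irreflexive :
  (forall (F : finType) (r : rel F), K r -> irreflexive r) -> forall x, ~ R x x.
Proof.
move=> Kirr x Rxx; have x_in : (x : {classic D}) \in [:: (x : {classic D})].
  exact: mem_head.
by have /(_ (SeqSub x_in))/asboolP := Kirr _ _ (fraisse_limit_age [:: x]).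
Qed.

(** With [P] arbitrary, symmetry of graphs and the tournament axiom are both instances. *)
Lemma fraisse_limit_binary (P : Prop -> Prop -> Prop) :
  (forall (F : finType) (r : rel F), K r -> forall a b, a != b -> P (r a b) (r b a)) ->
  forall x y, x <> y -> P (R x y) (R y x).
Proof.
move=> KP x y xy; pose s : seq {classic D} := [:: x; y].
have xs : (x : {classic D}) \in s by rewrite inE eqxx.
have ys : (y : {classic D}) \in s by rewrite !inE eqxx orbT.
have := KP _ _ (fraisse_limit_age s) (SeqSub xs) (SeqSub ys).
by rewrite !asboolE; apply; apply/eqP => -[].
Qed.

Lemma fraisse_limit_transitive :
  (forall (F : finType) (r : rel F), K r -> transitive r) ->
  forall x y z, R x y -> R y z -> R x z.
Proof.
move=> Ktr x y z; pose s : seq {classic D} := [:: x; y; z].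
have xs : (x : {classic D}) \in s by rewrite inE eqxx.
have ys : (y : {classic D}) \in s by rewrite !inE eqxx orbT.
have zs : (z : {classic D}) \in s by rewrite !inE eqxx !orbT.
have := Ktr _ _ (fraisse_limit_age s) (SeqSub ys) (SeqSub xs) (SeqSub zs).
by rewrite !asboolE.
Qed.

Lemma fraisse_limit_double (S : D * bool -> D * bool -> Prop) :
  (forall (F : finType) (f : F -> D * bool), injective f ->
    K (fun a b : F => `[< S (f a) (f b) >])) ->
  D -> exists e, embedding S R e.
Proof.
move=> ageS d0; have [/countable_injP[c c_inj] _ _] := limR.
apply: (fraisse_limit_universal limR d0 (c := fun p => pickle (c p.1, p.2))) ageS.
move=> [a i] [b j] /(pcan_inj pickleK)[ab ->].
by rewrite (c_inj a b) // inE.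
Qed.

End Age.

(** By irreflexivity all one-point substructures are isomorphic. *)
Lemma homogeneous_transitive D (R : D -> D -> Prop) :
  homogeneous R -> (forall x, ~ R x x) ->
  forall x y, exists h, automorphism R h /\ h x = y.
Proof.
move=> homR irrR x y.
have [|_ _ /set_mem-> /set_mem->|_ _ -> ->|h [ah hx]] // := homR [set x] (fun=> y).
  by split => /irrR.
by exists h; split => //; exact: hx.
Qed.

Definition finite_linear_order : fclass :=
  fun F r => finite_tournament r /\ transitive r.

Section RationalOrder.
Local Open Scope ring_scope.

Lemma automorphism_ltQ (h g : rat -> rat) :
  cancel h g -> cancel g h -> {homo h : x y / x < y} -> automorphism ltQ h.
Proof.
move=> hK gK hlt; split; first by exists g.
by move=> x y; rewrite /ltQ; rewrite (leW_mono (le_mono hlt)).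
Qed.

(** Induction peels off the least point [a]: the extension [h] for the remaining points is kept from
    the next point [b] upwards, and below [b] it is replaced by the line through [(a, p a)] and
    [(b, p b)]. A single point needs only a translation. *)
Lemma extend_ltQ (p : rat -> rat) (s : seq rat) :
  sorted <%R s -> {in s &, {homo p : x y / x < y}} ->
  exists h, automorphism ltQ h /\ {in s, h =1 p}.
Proof.
elim: s => [|a [|b s] IH] srt mono.
- by exists id; split=> //; apply: (automorphism_ltQ (g := id)).
- exists (fun z => z + (p a - a)); split.
    apply: (automorphism_ltQ (g := fun z => z - (p a - a))) => [z|z|x y] /=.
    + by rewrite addrK.
    + by rewrite subrK.
    + by rewrite ltrD2r.
  by move=> z /[!inE]/eqP ->; rewrite addrC subrK.
have /andP[ab srt'] : (a < b) && path <%R b s := srt.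
have [|h [ah hp]] := IH srt'.
  by move=> x y xs ys; apply: mono; rewrite inE ?xs ?ys orbT.
have [[g hK gK] hlt] := ah; rewrite /ltQ in hlt.
have hb : h b = p b by apply: hp; rewrite mem_head.
have pab : p a < p b by apply: mono; rewrite ?inE ?eqxx ?orbT.
(* The slope of that line; the inverse map has slope [1 / k] below [p b]. *)
pose k := (p b - p a) / (b - a).
have k0 : 0 < k by rewrite divr_gt0 ?subr_gt0.
have kk z : z / k * k = z by rewrite divfK // gt_eqF.
have glt x y : x < y -> g x < g y by move=> xy; apply/hlt; rewrite !gK.
have gpb : g (p b) = b by rewrite -hb hK.
exists (fun z => if b <= z then h z else p b + k * (z - b)); split.
  apply: (automorphism_ltQ
    (g := fun w => if p b <= w then g w else b + (w - p b) / k)) => [z|w|x y] /=.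
  - case: (leP b z) => bz; last first.
      rewrite ifF; last by apply/negP; nra.
      by rewrite addrAC subrr add0r mulrAC divff ?gt_eqF // mul1r addrC subrK.
    rewrite hK ifT // -hb; move: bz; rewrite le_eqVlt => /orP[/eqP->//|].
    by move/hlt/ltW.
  - case: (leP (p b) w) => bw; last first.
      have w0 : (w - p b) / k < 0 by rewrite pmulr_llt0 ?invr_gt0 ?subr_lt0.
      rewrite ifF; last by apply/negP; lra.
      by rewrite addrAC subrr add0r mulrC kk addrC subrK.
    rewrite gK ifT //; move: bw; rewrite le_eqVlt => /orP[/eqP<-|].
      by rewrite gpb.
    by move/glt; rewrite gpb => /ltW.
  - move=> xy; case: (leP b x) => bx.
      by rewrite (le_trans bx (ltW xy)); exact: (hlt x y).1.
    case: (leP b y) => b_y; last by rewrite ltrD2l ltr_pM2l // ltrD2r.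
    have hby : p b <= h y.
      move: b_y; rewrite -hb le_eqVlt => /orP[/eqP->//|b_y].
      exact: ltW ((hlt b y).1 b_y).
    apply: lt_le_trans hby; rewrite -[ltRHS]addr0 ltrD2l.
    by rewrite pmulr_rlt0 // subr_lt0.
move=> z /[1!inE]/orP[/eqP->|zs].
  rewrite leNgt ab /= -[a - b]opprB mulrN /k divfK; first by lra.
  by rewrite gt_eqF // subr_gt0.
rewrite ifT; first exact: hp.
move: srt'; rewrite (path_sortedE lt_trans) => /andP[/allP bs _].
by move: zs => /[1!inE]/orP[/eqP->//|/bs/ltW]. 
Qed.

Lemma homogeneous_ltQ : homogeneous ltQ.
Proof.
move=> A p /finite_seqP[s ->] p_inj pR.
have [|x y|h [ah hp]] := @extend_ltQ p (sort <=%R (undup s)).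
- by rewrite sort_lt_sorted undup_uniq.
- by rewrite !mem_sort !mem_undup => xs ys; apply: (pR x y xs ys).1.
by exists h; split => // x xs; apply: hp; rewrite mem_sort mem_undup.
Qed.

Lemma fraisse_limit_ltQ : fraisse_limit finite_linear_order ltQ.
Proof.
split; [exact: countableP|exact: homogeneous_ltQ|move=> F r; split].
  (* A finite linear order embeds by rank, the number of predecessors. *)
  move=> [[irr tot] tr]; pose f a : rat := #|[pred b | r b a]|%:R.
  have fr a b : r a b -> (f a < f b)%R.
    move=> ab; rewrite ltr_nat; apply: proper_card; apply/properP; split.
      by apply/fintype.subsetP => c; rewrite !inE => /tr; apply.
    by exists a; rewrite inE ?irr.
  have fE a b : r a b <-> ltQ (f a) (f b).
    split=> [/fr//|]; case: (eqVneq a b) => [->|/tot]; first by rewrite /ltQ ltxx.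
    by case: (r a b) => //= /fr /lt_trans h /h; rewrite ltxx.
  exists f; split => // a b fab; apply/eqP/negPn/negP => /tot.
  case ab: (r a b); first by move/fr: ab; rewrite fab ltxx.
  by case ba: (r b a) => //; move/fr: ba; rewrite fab ltxx.
move=> [f [fi fr]]; have rE a b : r a b = (f a < f b)%R by apply/idP/idP => /fr.
split; [split => [a|a b ab]|move=> b a c]; rewrite !rE ?ltxx //.
  by case: ltgtP => // /fi ab'; rewrite ab' eqxx in ab.
exact: lt_trans.
Qed.

End RationalOrder.

(** * Structures on two copies of the domain *)

(* [S] lives on two copies of [D]; each of the first three conditions chooses a
   copy of each point so that the chosen points form a copy of [R], and the last condition makes the two copies of [D] minus [x]
   completely adjacent to each other. *)
Record doubling D (R : D -> D -> Prop) (x : D)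
    (S : D * bool -> D * bool -> Prop) : Prop := Doubling {
  doubling0 : forall a b, R a b <-> S (a, false) (b, false);
  doublingx : forall a b, R a b <-> S (a, `[< a = x >]) (b, `[< b = x >]);
  doublingNx : forall a b, R a b <-> S (a, `[< a <> x >]) (b, `[< b <> x >]);
  doubling_cross : forall a b, a <> x -> b <> x ->
    S (a, false) (b, true) \/ S (b, true) (a, false) }.

Lemma section_embedding D (R : D -> D -> Prop) (S : D * bool -> D * bool -> Prop)
    (i : D -> bool) :
  (forall a b, R a b <-> S (a, i a) (b, i b)) ->
  embedding R S (fun a => (a, i a)).
Proof. by split=> // a b []. Qed.

Lemma embedding_through_point D (R : D -> D -> Prop)
    (S : D * bool -> D * bool -> Prop) (e : D * bool -> D) p x :
  homogeneous R -> (forall x, ~ R x x) -> embedding S R e ->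
  exists2 e', embedding S R e' & e' p = x.
Proof.
move=> homR irrR eS.
have [h [/automorphism_embedding hR hx]] := homogeneous_transitive homR irrR (e p) x.
by exists (h \o e) => //; exact: embedding_comp hR.
Qed.

(** One map uses the copy [false] throughout, the other uses [true] except at [x], so they share
    [e (x, false)]. All other cross pairs are related by [R], and [s] identifying one would create a
    loop. [T] is kept apart from [R] to allow a linear extension. *)
Lemma doubling_cover D (R T : D -> D -> Prop) L (Y : structure L D) x S e :
  doubling T x S -> embedding S R e -> e (x, false) = x -> no_loop R Y ->
  (forall i, (forall a b, T a b <-> S (a, i a) (b, i b)) ->
    is_endo Y (fun a => e (a, i a))) ->
  exists g1 g2 : endo Y,
    [/\ exists z, g1 z = x, exists z, g2 z = x &
        forall (s : endo Y) z1 z2, s (g1 z1) = s (g2 z2) -> s (g1 z1) = s x].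
Proof.
move=> [S0 _ SNx crossS] eS ex nloop endo_e.
exists (Endo (endo_e _ S0)), (Endo (endo_e _ SNx)); split => [||s a b /=].
- by exists x.
- by exists x; rewrite /= asboolF.
have [->|ax] := pselect (a = x); first by rewrite ex.
have [->|bx] := pselect (b = x); first by rewrite asboolF // ex.
rewrite asboolT // => sab; case: nloop; exists s.
case: (crossS a b ax bx) => /eS.2 Rab.
  by exists (e (a, false)), (e (b, true)).
by exists (e (b, true)), (e (a, false)).
Qed.

Definition doublable D (R : D -> D -> Prop) : Prop :=
  [/\ homogeneous R, forall x, ~ R x x &
      forall x, exists2 S, doubling R x S & exists e, embedding S R e].

Lemma doublable_zariski D (R : D -> D -> Prop) L (Y : structure L D) :
  doublable R -> fo_definition (binary R) Y -> no_loop R Y ->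
  zariski_is_pointwise Y.
Proof.
move=> [homR irrR dbl] defY nloop; apply: zariski_is_pointwiseP => [y|x].
  (* The sections of [S0] and [Sy] choose different copies of [y] and the same copy of every other
     point. *)
  have [S [S0 Sy _ _] [e eS]] := dbl y.
  have endo_e (i : D -> bool) (iR : forall a b, R a b <-> S (a, i a) (b, i b)) :=
    embedding_endo homR defY (embedding_comp (section_embedding iR) eS).
  exists (Endo (endo_e _ S0)), (Endo (endo_e _ Sy)); split => [/= /eS.1[]|z zy /=].
    by rewrite asboolT.
  by rewrite asboolF.
have [S dblS [e0 e0S]] := dbl x.
have [e eS ex] := embedding_through_point (x, false) x homR irrR e0S.
apply: (doubling_cover dblS eS ex nloop) => i iR.
exact: (embedding_endo homR defY (embedding_comp (section_embedding iR) eS)).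
Qed.

(** Both copies of [x] keep exactly the neighbours of [x], so either can stand for [x]; any other
    two points in different copies are joined both ways. *)
Definition joined_copies D (R : D -> D -> Prop) (x : D) (p q : D * bool) : Prop :=
  R p.1 q.1 \/ [/\ p.2 <> q.2, p.1 <> x & q.1 <> x].

Lemma doubling_joined D (R : D -> D -> Prop) x : doubling R x (joined_copies R x).
Proof.
split=> [a b|a b|a b|a b ax bx]; rewrite /joined_copies /=.
- by split; [left|case=> // -[]].
- split; [by left|case=> // -[+ ax bx]].
  by rewrite !asboolF.
- split; [by left|case=> // -[+ ax bx]].
  by rewrite !asboolT.
- by left; right.
Qed.

(** The lexicographic product of [R] with a two-element chain: each point becomes a pair of twins,
    [false] before [true]. *)
Definition lex_copies D (R : D -> D -> Prop) (p q : D * bool) : Prop :=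
  R p.1 q.1 \/ p.1 = q.1 /\ ~~ p.2 && q.2.

Section LexCopies.
Variables (D : Type) (R : D -> D -> Prop).
Hypothesis irrR : forall x, ~ R x x.

(** A section contains only one twin of each point, so every section is a copy of [R]. Totality
    relates cross pairs over distinct points, and the chain relates twins. *)
Lemma doubling_lex x :
  (forall a b, a <> b -> R a b \/ R b a) -> doubling R x (lex_copies R).
Proof.
move=> totR; have secE (i : D -> bool) a b :
    R a b <-> lex_copies R (a, i a) (b, i b).
  by split; [left|case=> //= -[-> /andP[/negP]]].
split=> [a b|||a b ax bx]; try exact: secE.
rewrite /lex_copies /=; have [->|/totR[]] := pselect (a = b).
- by left; right.
- by left; left.
- by right; left.
Qed.

Lemma lex_copies_irreflexive p : ~ lex_copies R p p.
Proof. by case=> [/irrR//|[_]]; case: p.2. Qed.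

Lemma lex_copies_tournament p q :
  (forall a b, a <> b -> (R a b \/ R b a) /\ ~ (R a b /\ R b a)) -> p <> q ->
  (lex_copies R p q \/ lex_copies R q p) /\
  ~ (lex_copies R p q /\ lex_copies R q p).
Proof.
case: p q => [a i] [b j] torR pq; rewrite /lex_copies /=.
have [ab|/[dup] ab /torR] := pselect (a = b); last by intuition.
rewrite {}ab in pq *; have := @irrR b.
by case: i j pq => [] [] pq; rewrite ?andbF /=; intuition.
Qed.

Lemma lex_copies_transitive p q r :
  (forall a b c, R a b -> R b c -> R a c) ->
  lex_copies R p q -> lex_copies R q r -> lex_copies R p r.
Proof.
move=> trR [pq|[pq /andP[i j]]] [qr|[qr /andP[i' j']]].
- by left; apply: trR qr.
- by left; rewrite -qr.
- by left; rewrite pq.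
- by rewrite j in i'.
Qed.

End LexCopies.

(** * Doublings of the four base structures *)

Lemma random_graph_doublable D (R : D -> D -> Prop) :
  random_graph R -> doublable R.
Proof.
move=> limR; have irrR := fraisse_limit_irreflexive limR (fun F r => @proj1 _ _).
have symR x y : R x y -> R y x.
  have [->|/(fraisse_limit_binary limR (P := fun p q => p -> q))] // := pselect (x = y).
  by apply=> F r [_ r_sym] a b _; rewrite r_sym.
split=> // [|x]; first by case: limR.
exists (joined_copies R x); first exact: doubling_joined.
apply: (fraisse_limit_double limR _ x) => F f _; split=> [a|a b].
  by apply/asboolP => -[/irrR|[]].
by apply: asbool_equiv_eq; split=> -[/symR|[? ? ?]]; [left|right|left|right];
  rewrite // ?/joined_copies; split=> // /esym.
Qed.

Lemma random_digraph_doublable D (R : D -> D -> Prop) :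
  random_digraph R -> doublable R.
Proof.
move=> limR; have irrR := fraisse_limit_irreflexive limR (fun F r => id).
split=> // [|x]; first by case: limR.
exists (joined_copies R x); first exact: doubling_joined.
apply: (fraisse_limit_double limR _ x) => F f _ a.
by apply/asboolP => -[/irrR|[]].
Qed.

Lemma asbool_xor (P Q : Prop) : (P \/ Q) /\ ~ (P /\ Q) -> `[< P >] (+) `[< Q >].
Proof.
by case=> PQ nPQ; case: asboolP => p; case: asboolP => q //=; case: PQ => // _; case: nPQ.
Qed.

Lemma xor_asbool (p q : bool) : p (+) q -> (p \/ q) /\ ~ (p /\ q).
Proof. by case: p q => [] [] //= _; split; [left|case|right|case]. Qed.

Lemma limit_tournament (K : fclass) D (R : D -> D -> Prop) :
  fraisse_limit K R -> (forall (F : finType) (r : rel F), K F r -> finite_tournament r) ->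
  forall x y, x <> y -> (R x y \/ R y x) /\ ~ (R x y /\ R y x).
Proof.
move=> limR Ktor; apply: (fraisse_limit_binary limR
  (P := fun p q => (p \/ q) /\ ~ (p /\ q))) => F r /Ktor[_ tor] a b /tor.
exact: xor_asbool.
Qed.

Lemma lex_copies_finite_tournament D (R : D -> D -> Prop) (F : finType)
    (f : F -> D * bool) :
  (forall x, ~ R x x) ->
  (forall x y, x <> y -> (R x y \/ R y x) /\ ~ (R x y /\ R y x)) ->
  injective f ->
  finite_tournament (fun a b : F => `[< lex_copies R (f a) (f b) >]).
Proof.
move=> irrR torR fi; split=> [a|a b /eqP ab].
  by apply/asboolP; exact: lex_copies_irreflexive.
by apply: asbool_xor; apply: lex_copies_tournament => // /fi.
Qed.

Lemma random_tournament_doublable D (R : D -> D -> Prop) :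
  random_tournament R -> doublable R.
Proof.
move=> limR; have irrR := fraisse_limit_irreflexive limR (fun F r => @proj1 _ _).
have torR := limit_tournament limR (fun F r => id).
split=> // [|x]; first by case: limR.
exists (lex_copies R); first by apply: doubling_lex => // a b /torR[].
apply: (fraisse_limit_double limR _ x) => F f fi.
exact: lex_copies_finite_tournament.
Qed.

Lemma ltQ_doublable : doublable ltQ.
Proof.
have irrR x : ~ ltQ x x by rewrite /ltQ ltxx.
have torR x y : x <> y -> (ltQ x y \/ ltQ y x) /\ ~ (ltQ x y /\ ltQ y x).
  move/eqP=> xy; apply: xor_asbool; move: xy.
  by case: ltgtP.
split=> // [|x]; first exact: homogeneous_ltQ.
exists (lex_copies ltQ); first by apply: doubling_lex => // a b /torR[].
apply: (fraisse_limit_double fraisse_limit_ltQ _ x) => F f fi; split.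
  exact: lex_copies_finite_tournament.
move=> b a c /asboolP ab /asboolP bc; apply/asboolP.
by apply: lex_copies_transitive ab bc => u v w; exact: lt_trans.
Qed.

Lemma base_structure_doublable D (R : D -> D -> Prop) :
  base_structure R -> doublable R.
Proof.
case=> {D R} [D R|D R||D R].
- exact: random_graph_doublable.
- exact: random_digraph_doublable.
- exact: ltQ_doublable.
- exact: random_tournament_doublable.
Qed.

(** * Strict orders, copies of K_omega, expansions *)

Lemma binary_endo D (R : D -> D -> Prop) (f : D -> D) :
  (forall x y, R x y -> R (f x) (f y)) -> is_endo (binary R) f.
Proof. by move=> fR; split => [[]|r a]; apply: fR. Qed.

Lemma endo_binary D (R : D -> D -> Prop) (f : endo (binary R)) x y :
  R x y -> R (f x) (f y).
Proof.
have := (endoP f).2 tt (tcons x (fun=> y)).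
by rewrite /= /tcons unlift_none (_ : ord_max = lift ord0 ord0) ?liftK //; exact: val_inj.
Qed.

Lemma binary_no_loop D (R : D -> D -> Prop) :
  (forall x, ~ R x x) -> no_loop R (binary R).
Proof. by move=> irrR [f [x [y [/(endo_binary f) + fxy]]]]; rewrite fxy => /irrR. Qed.

(** * A linear extension of a countable strict order *)

Section LinearExtension.
Variables (D : Type) (R : D -> D -> Prop) (c : D -> nat).
Hypothesis irrR : forall x, ~ R x x.
Hypothesis trR : forall x y z, R x y -> R y z -> R x z.
Hypothesis c_inj : injective c.

Let below (x : D) (n : nat) : bool := `[< exists d, c d = n /\ (R d x \/ d = x) >].

(* Lexicographic comparison of the characteristic functions of the principal
   down-sets, along the enumeration [c]. *)
Definition lex_below (x y : D) : Prop :=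
  exists n, [/\ ~~ below x n, below y n &
    forall m, (m < n)%N -> below x m = below y m].

Lemma below_self x : below x (c x).
Proof. by apply/asboolP; exists x; split=> //; right. Qed.

Lemma below_c x y : below y (c x) -> R x y \/ x = y.
Proof. by case/asboolP=> d [/c_inj ->]. Qed.

Lemma below_sub x y n : R x y -> below x n -> below y n.
Proof.
move=> xy /asboolP[d [<- dx]]; apply/asboolP; exists d; split=> //; left.
by case: dx => [/trR|->]; first exact.
Qed.

(** If the principal down-sets of [x] and [y] agreed, each point would lie below the other, against
    irreflexivity. *)
Lemma first_difference x y : x <> y ->
  exists n, below x n != below y n /\ forall m, (m < n)%N -> below x m = below y m.
Proof.
move=> xy; have ex : exists n, below x n != below y n.
  apply: contrapT => /forallNP eqxy.
  have {}eqxy n : below x n = below y n by apply/eqP/negPn/negP/eqxy.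
  have := below_self x; rewrite eqxy => /below_c[Rxy|//].
  have := below_self y; rewrite -eqxy => /below_c[/(trR Rxy)/irrR|/esym] //.
exists (ex_minn ex); case: ex_minnP => n xyn minn; split=> // m mn.
by apply/eqP/negPn/negP => /minn; rewrite leqNgt mn.
Qed.

Lemma lex_below_irreflexive x : ~ lex_below x x.
Proof. by case=> n [/negP]. Qed.

Lemma lex_below_transitive x y z :
  lex_below x y -> lex_below y z -> lex_below x z.
Proof.
move=> [n [xn yn xy]] [k [yk zk yz]]; case: (ltngtP n k) => nk.
- exists n; split=> // [|m mn]; first by rewrite -yz.
  by rewrite xy ?yz // (ltn_trans mn).
- exists k; split=> // [|m mk]; first by rewrite xy.
  by rewrite xy ?yz // (ltn_trans mk).
- by rewrite nk (negPf yk) in yn.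
Qed.

Lemma lex_below_total x y : x <> y -> lex_below x y \/ lex_below y x.
Proof.
case/first_difference=> n [xyn xy].
case xn: (below x n) in xyn; case yn: (below y n) in xyn => //.
  by right; exists n; rewrite yn; split=> // m /xy.
by left; exists n; rewrite xn; split=> // m /xy.
Qed.

(** The down-set of [x] is contained in that of [y], so the first difference can only be a point
    below [y] and not below [x]. *)
Lemma lex_below_extends x y : R x y -> lex_below x y.
Proof.
move=> Rxy; have /first_difference[n [xyn xy]] : x <> y.
  by move=> xy; move: Rxy; rewrite xy => /irrR.
exists n; have := @below_sub x y n Rxy; move: xyn.
case: (below x n) (below y n) => [] [] // _ h; first have := h isT.
by split.
Qed.

End LinearExtension.

Lemma strict_order_zariski D (R : D -> D -> Prop) :
  random_strict_order R -> zariski_is_pointwise (binary R).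
Proof.
move=> limR; have irrR := fraisse_limit_irreflexive limR (fun F r => @proj1 _ _).
have trR := fraisse_limit_transitive limR (fun F r => @proj2 _ _).
have [/countable_injP[c c_inT] homR _] := limR.
have {c_inT}c_inj : injective c by move=> x y; apply: c_inT; rewrite in_setT.
apply: zariski_is_pointwiseP => [y|x].
  (* Each point gets an incomparable twin with the same relations, so moving [y] alone to its twin
     is an endomorphism. *)
  pose S (p q : D * bool) := R p.1 q.1.
  have [||e [ei eS]] := @fraisse_limit_double _ _ _ limR S.
  - move=> F f _; split=> [a|b a d /asboolP ab /asboolP bd]; apply/asboolP.
      exact: irrR.
    exact: trR ab bd.
  - exact: y.
  have endo_e (i : D -> bool) : is_endo (binary R) (fun a => e (a, i a)).
    by apply: binary_endo => a b ab; apply/eS.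
  exists (Endo (endo_e (fun=> false))), (Endo (endo_e (fun a => `[< a = y >]))).
  by split=> [/= /ei[]|z zy /=]; [rewrite asboolT|rewrite asboolF].
(* [lex_copies T] is a linear order, hence embeds in [R]. Since [T] contains [R], its sections still
   give endomorphisms. *)
pose T := lex_below R c.
have irrT : forall x, ~ T x x by exact: lex_below_irreflexive.
have dblT : doubling T x (lex_copies T).
  by apply: doubling_lex => // a b; exact: lex_below_total.
have [||e0 e0S] := @fraisse_limit_double _ _ _ limR (lex_copies T).
- move=> F f _; split=> [a|b a d /asboolP ab /asboolP bd]; apply/asboolP.
    exact: lex_copies_irreflexive.
  by apply: lex_copies_transitive ab bd; exact: lex_below_transitive.
- exact: x.
have [e eS ex] := embedding_through_point (x, false) x homR irrR e0S.
apply: (doubling_cover dblT eS ex) => [|i iT]; first exact: binary_no_loop.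
by apply: binary_endo => a b /(lex_below_extends irrR trR c_inj)/iT/eS.2.
Qed.

Lemma copies_Komega_zariski (C : Type) :
  zariski_is_pointwise (binary (@copies_Komega C)).
Proof.
have endoC (h : C * nat -> C) (g : C * nat -> nat) :
    (forall z w, z.1 = w.1 -> h z = h w) ->
    (forall z w, z.1 = w.1 -> g z = g w -> z = w) ->
    is_endo (binary (@copies_Komega C)) (fun z => (h z, g z)).
  move=> hP gP; apply: binary_endo => z w [zw1 zw2]; split=> /=; first exact: hP.
  by move=> /(gP _ _ zw1) zw; rewrite zw in zw2.
apply: zariski_is_pointwiseP => [y|x].
  (* The shift frees the value 0 in every component, and [g] sends [y] there. *)
  pose f (z : C * nat) := z.2.+1.
  pose g (z : C * nat) := if `[< z = y >] then 0%N else z.2.+1.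
  have fE : is_endo (binary (@copies_Komega C)) (fun z => (z.1, f z)).
    by apply: endoC => // -[z k] [w l] /= -> [->].
  have gE : is_endo (binary (@copies_Komega C)) (fun z => (z.1, g z)).
    apply: endoC => // -[z k] [w l] /= ->; rewrite /g.
    by case: asboolP => [->|_]; case: asboolP => [->|_] //= [->].
  exists (Endo fE), (Endo gE); split=> [|z zy] /=; rewrite /g.
    by rewrite asboolT // => -[].
  by rewrite asboolF.
(* All components are mapped into that of [x], with offsets 0, 2, 4, ... here and 0, 1, 3, 5, ...
   for the second map, where the truncated predecessor of 0 is 0. Only the offset 0, that is [x], is
   common. *)
have fE : is_endo (binary (@copies_Komega C)) (fun z => (x.1, x.2 + z.2.*2)%N).
  apply: (endoC (fun=> x.1)) => // -[z k] [w l] /= -> kl; congr pair; lia.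
have gE : is_endo (binary (@copies_Komega C)) (fun z => (x.1, x.2 + z.2.*2.-1)%N).
  apply: (endoC (fun=> x.1)) => // -[z k] [w l] /= -> kl; congr pair; lia.
exists (Endo fE), (Endo gE); split=> [||s z w /= szw].
- by exists (x.1, 0%N); rewrite /= addn0; case: x {fE gE}.
- by exists (x.1, 0%N); rewrite /= addn0; case: x {fE gE}.
(* Equal offsets are both 0; unequal ones give adjacent points, which [s] cannot identify. *)
have [zw|zw] := eqVneq (x.2 + z.2.*2)%N (x.2 + w.2.*2.-1)%N.
  have -> : z.2 = 0%N by lia.
  by rewrite addn0; case: x {fE gE szw zw}.
have /(endo_binary s)[_] : copies_Komega (x.1, x.2 + z.2.*2)%N (x.1, x.2 + w.2.*2.-1)%N.
  by split=> //; apply/eqP.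
by rewrite szw.
Qed.

Section Expansion.
Variables (D : Type) (R : D -> D -> Prop).

Lemma fo_definition_binary : fo_definition (binary R) (binary R).
Proof.
split=> [[]|[]]; pose v i := @Var binary_sig 2 i.
by exists (@FRel binary_sig 2 tt v).
Qed.

Lemma fo_definition_expansion (I : Type) (ar : I -> nat)
    (P : forall i : I, ('I_(ar i) -> D) -> Prop) :
  (forall i : I, definable_rel (binary R) (P i)) ->
  fo_definition (binary R) (expansion (binary R) P).
Proof.
move=> defP; split=> [[]|[r|i]]; last exact: defP.
exact: fo_definition_binary.2.
Qed.

(** Every endomorphism of the expansion is one of the original structure. *)
Lemma expansion_no_loop (I : Type) (ar : I -> nat)
    (P : forall i : I, ('I_(ar i) -> D) -> Prop) :
  no_loop R (binary R) -> no_loop R (expansion (binary R) P).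
Proof.
move=> nloop [f [x [y [Rxy fxy]]]]; apply: nloop.
have fR : is_endo (binary R) f.
  by split=> [[]|r a]; exact: (endoP f).2 (inl r) a.
by exists (Endo fR), x, y.
Qed.

End Expansion.

Theorem theorem3p9 :
  (* (i) *)
  (forall (D : Type) (R : D -> D -> Prop),
     random_graph R -> zariski_is_pointwise (binary R)) /\
  (* (ii) *)
  (forall (D : Type) (R : D -> D -> Prop),
     random_digraph R -> zariski_is_pointwise (binary R)) /\
  (* (iii) *)
  zariski_is_pointwise (binary ltQ) /\
  (* (iv) *)
  (forall (D : Type) (R : D -> D -> Prop),
     random_tournament R -> zariski_is_pointwise (binary R)) /\
  (* (v) *)
  (forall (D : Type) (R : D -> D -> Prop),
     random_strict_order R -> zariski_is_pointwise (binary R)) /\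
  (* (vi) *)
  (forall n : nat, (0 < n)%N ->
     zariski_is_pointwise (binary (@copies_Komega 'I_n))) /\
  zariski_is_pointwise (binary (@copies_Komega nat)) /\
  (* (vii) *)
  (forall (D : Type) (R : D -> D -> Prop), base_structure R ->
     no_loop R (binary R) /\
     (forall (L : signature) (Y : structure L D),
        fo_definition (binary R) Y -> no_loop R Y ->
        zariski_is_pointwise Y) /\
     (forall (I : Type) (ar : I -> nat)
             (P : forall i : I, ('I_(ar i) -> D) -> Prop),
        (forall i : I, definable_rel (binary R) (P i)) ->
        fo_definition (binary R) (expansion (binary R) P) /\
        no_loop R (expansion (binary R) P) /\
        zariski_is_pointwise (expansion (binary R) P))).
Proof.
have base D (R : D -> D -> Prop) : base_structure R ->
    zariski_is_pointwise (binary R).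
  move=> /base_structure_doublable dblR; apply: (doublable_zariski dblR).
    exact: fo_definition_binary.
  by case: dblR => _ irrR _; exact: binary_no_loop.
split; first by move=> D R /Base_random_graph/base.
split; first by move=> D R /Base_random_digraph/base.
split; first exact: base Base_rat_order.
split; first by move=> D R /Base_random_tournament/base.
split; first by move=> D R; exact: strict_order_zariski.
split; first by move=> n _; exact: copies_Komega_zariski.
split; first exact: copies_Komega_zariski.
move=> D R /base_structure_doublable dblR; have [_ irrR _] := dblR.
have nloop := binary_no_loop irrR; split=> //; split=> [L Y|I ar P defP].
  exact: doublable_zariski.
have defX := fo_definition_expansion defP.
have nloopX := expansion_no_loop (P := P) nloop.
by split=> //; split=> //; exact: doublable_zariski defX nloopX.
Qed.
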